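(* Let $F$ be a once-punctured torus equipped with a point of the decorated super Teichmüller space $S\tilde T(F)$ with values in the Grassmann algebra $\mathbb{R}_{S[N]}$. For every $\delta>0$ there exists a constant $M=M_{\delta}\geq 1$ (depending on $\delta$ and the point) such that \[ \|s(a)\|\leq M\cdot|\epsilon(a)|^{1+\delta} \] for the super $\lambda$-length $a$ of every ideal arc of $F$.
   Context: $\mathbb{R}_{S[N]}$ is the real Grassmann algebra generated by anticommuting $\beta_{[1]},\dots,\beta_{[N]}$; each $x$ is $\sum_\lambda x_\lambda\beta_{[\lambda]}$ over increasing multi-indices, the body $\epsilon(x)$ is the coefficient of $1$, the soul is $s(x)=x-\epsilon(x)\cdot1$, and $\|x\|=\sum_\lambda|x_\lambda|$. $S\tilde T(F)$ is the decorated $\mathrm{OSp}(1|2)$ super Teichmüller space (Penner–Zeitlin): a point assigns to every ideal arc of $F$ an even super $\lambda$-length with positive body, to the triangles of each ideal triangulation odd $\mu$-invariants, together with a spin structure; $\lambda$-lengths of the arcs of a triangulation $a,b,c$ and of the arc $d$ obtained by flipping $c$ satisfy $cd=a^2+b^2+abW_c$, with $W_c$ the product of the $\mu$-invariants of the two triangles adjacent to $c$ (ordered counter-clockwise then clockwise relative to the spin orientation of $c$). *)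

(* Defs.v *)
From HB Require Import structures.
From mathcomp Require Import all_boot all_order all_algebra.
From mathcomp Require Import reals exp.
Set Implicit Arguments. Unset Strict Implicit. Unset Printing Implicit Defensive.
Import Order.TTheory GRing.Theory Num.Theory.
Local Open Scope ring_scope.

(* The real Grassmann algebra R_{S[N]} generated by beta_0..beta_{N-1}. *)
(* An element is x = sum_lambda x_lambda beta_[lambda], lambda ranging  *)
(* over increasing multi-indices = subsets of 'I_N.                     *)
Section Grassmann.
Variables (R : realType) (N : nat).

Definition grass := {ffun {set 'I_N} -> R}.

Definition gconst (c : R) : grass := [ffun S : {set 'I_N} => if S == set0 then c else 0].
Definition gadd (x y : grass) : grass := [ffun S : {set 'I_N} => x S + y S].
Definition gscale (c : R) (x : grass) : grass := [ffun S : {set 'I_N} => c * x S].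

(* sign of beta_[A] beta_[B] = gsign A B * beta_[A u B] for disjoint A B *)
Definition gsign (A B : {set 'I_N}) : R :=
  (-1) ^+ #|[set p : 'I_N * 'I_N |
             [&& p.1 \in A, p.2 \in B & (nat_of_ord p.2 < nat_of_ord p.1)%N]]|.

(* product: beta_i^2 = 0, beta_i beta_j = - beta_j beta_i *)
Definition gmul (x y : grass) : grass :=
  [ffun S : {set 'I_N} => \sum_(A : {set 'I_N} | A \subset S)
               gsign A (S :\: A) * x A * y (S :\: A)].

Definition body (x : grass) : R := x set0.
Definition soul (x : grass) : grass := gadd x (gconst (- body x)).
Definition grnorm (x : grass) : R := \sum_(S : {set 'I_N}) `|x S|.
Definition geven (x : grass) : Prop := forall S : {set 'I_N}, odd #|S| -> x S = 0.
Definition godd (x : grass) : Prop := forall S : {set 'I_N}, ~~ odd #|S| -> x S = 0.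

Definition sgnb (b : bool) : R := if b then -1 else 1.
End Grassmann.

(* Combinatorics of the once-punctured torus.  Ideal arcs <-> slopes,   *)
(* i.e. primitive vectors (p,q) in Z^2 up to sign.  Ideal triangulations *)
(* <-> Farey triangles {x, y, x+y} with |det(x,y)| = 1; flipping the    *)
(* edge x+y of that triangulation gives the edge x-y, i.e. the          *)
(* triangulation {x, y, x-y}.                                           *)
Definition farc := (int * int)%type.
Definition padd (x y : farc) : farc := (x.1 + y.1, x.2 + y.2).
Definition pneg (x : farc) : farc := (- x.1, - x.2).
Definition det (x y : farc) : int := x.1 * y.2 - x.2 * y.1.
Definition prim (x : farc) : bool := coprimez x.1 x.2.
Definition nrm (x : farc) : farc :=
  if (x.2 < 0) || ((x.2 == 0) && (x.1 < 0)) then pneg x else x.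
Definition tri_seq (x y : farc) : seq farc := [:: nrm x; nrm y; nrm (padd x y)].

Section Point.
Variables (R : realType) (N : nat).
Local Notation G := (grass R N).

(* super Ptolemy relation for the lambda-lengths, flipping c = x+y to d = x-y
   in the triangulation {x,y,x+y}:  cd = a^2 + b^2 + ab W_c,
   W_c = +- (product of the two mu-invariants of the triangulation);
   the sign records the (counter-)clockwise ordering w.r.t. the spin
   orientation of c. *)
Definition ptolemy_rel (lam : farc -> G) (mu : farc -> farc -> G * G) (x y : farc) :=
  let a := lam x in let b := lam y in
  let W := gmul (mu x y).1 (mu x y).2 in
  exists e : bool,
    gmul (lam (padd x y)) (lam (padd x (pneg y))) =
    gadd (gadd (gmul a a) (gmul b b)) (gscale (sgnb R e) (gmul (gmul a b) W)).

(* Penner--Zeitlin transformation of the mu-invariants under that flip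
   (for the torus the quadrilateral has sides a,b,a,b):
     sigma' = (b sigma - a theta)/sqrt(a^2+b^2),
     theta' = (b theta + a sigma)/sqrt(a^2+b^2),
   up to the sign / labelling conventions dictated by the spin structure. *)
Definition muflip_rel (lam : farc -> G) (mu : farc -> farc -> G * G) (x y : farc) :=
  let a := lam x in let b := lam y in
  let s0 := (mu x y).1 in let t0 := (mu x y).2 in
  let s1 := (mu x (pneg y)).1 in let t1 := (mu x (pneg y)).2 in
  exists r : G, [/\ geven r, 0 < body r, gmul r r = gadd (gmul a a) (gmul b b) &
    exists sw sab s e1 e2 : bool,
      let p := if sab then b else a in let q := if sab then a else b in
      let u := if sw then t1 else s1 in let v := if sw then s1 else t1 in
      gmul r u = gscale (sgnb R e1) (gadd (gmul p s0) (gscale (sgnb R s) (gmul q t0)))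
   /\ gmul r v = gscale (sgnb R e2) (gadd (gmul p t0) (gscale (- sgnb R s) (gmul q s0)))].

(* A point of the decorated super Teichmueller space of the once-punctured
   torus with values in R_{S[N]}: lam = super lambda-lengths of the arcs,
   mu x y = the pair of mu-invariants of the two triangles of the
   triangulation {x, y, x+y}. *)
Definition super_torus_point (lam : farc -> G) (mu : farc -> farc -> G * G) : Prop :=
     (forall x, prim x -> geven (lam x) /\ 0 < body (lam x))
  /\ (forall x, lam (pneg x) = lam x)
  /\ (forall x y, `|det x y| = 1 -> godd (mu x y).1 /\ godd (mu x y).2)
  /\ (forall x y x' y', `|det x y| = 1 -> `|det x' y'| = 1 ->
          perm_eq (tri_seq x y) (tri_seq x' y') -> mu x y = mu x' y')
  /\ (forall x y, `|det x y| = 1 -> ptolemy_rel lam mu x y)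
  /\ (forall x y, `|det x y| = 1 -> muflip_rel lam mu x y).
End Point.

(* Main.v *)
Require Import Defs.
From HB Require Import structures.
From mathcomp Require Import all_boot all_order all_algebra.
From mathcomp Require Import reals sequences exp.
From mathcomp Require Import ring lra zify.
Set Implicit Arguments. Unset Strict Implicit. Unset Printing Implicit Defensive.
Import Order.TTheory GRing.Theory Num.Theory.
Local Open Scope ring_scope.

(* Write lam(x) = b(x) G(x) with b(x) the body, so that G(x) has body 1.  The
   product W of the two mu-invariants is invariant under flips up to sign, so
   for each Farey edge {x, y} the Ptolemy relation becomes
     G(x+y) = e(x,y) G(x) G(y),   e(x,x+y) = F e(x,y),
   where F = (1 + u^2 U^2 +- u U W) / (1 + u^2), u = b(x)/b(x+y) and
   U = (e(x,y) G(y))^-1.  Since u is at most 1/b(y) up to a constant, F is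
   exponentially close to 1 in the logarithmic size of the arc y dropped in
   passing from {x, y} to {x, x+y}.  Measuring elements together with their
   inverses in the norm sum |x_S| t^|S|, which is submultiplicative and in which
   finitely many given elements of body 1 have norm close to 1 once t is small, a
   Gronwall argument along the Farey tree gives |G|_t <= (k b)^delta, k constant,
   on every sector {px + qy : p, q >= 0} for which b(x+y) exceeds both b(x) and
   b(y).  The Markov invariant (a^2+b^2+c^2)/(abc) bounds the bodies from below, so that
   descending from any Farey triangle reaches such sectors in finitely many
   flips. *)

(** * The Grassmann algebra and its even subring *)

Section GrassmannRing.
Variables (R : realType) (N : nat).
Implicit Types A B C S : {set 'I_N}.

Definition inversions A B : {set 'I_N * 'I_N} :=
  [set p : 'I_N * 'I_N | [&& p.1 \in A, p.2 \in B & (p.2 < p.1)%N]].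

Lemma gsign_inversions A B : gsign R A B = (-1) ^+ #|inversions A B|.
Proof. by []. Qed.

Lemma gsignUr A B C : [disjoint B & C] ->
  gsign R A (B :|: C) = gsign R A B * gsign R A C.
Proof.
move=> dBC; rewrite !gsign_inversions -exprD; congr (_ ^+ _).
have -> : inversions A (B :|: C) = inversions A B :|: inversions A C.
  by apply/setP => p; rewrite !inE; case: (p.1 \in A) => //=; rewrite andb_orl.
rewrite cardsU (_ : _ :&: _ = set0) ?cards0 ?subn0 //.
apply/setP => p; rewrite !inE; apply/negbTE/negP.
case/andP=> /and3P[_ pB _] /and3P[_ pC _].
by move/pred0P: dBC => /(_ p.2); rewrite /= pB pC.
Qed.

Lemma gsignUl A B C : [disjoint A & B] ->
  gsign R (A :|: B) C = gsign R A C * gsign R B C.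
Proof.
move=> dAB; rewrite !gsign_inversions -exprD; congr (_ ^+ _).
have -> : inversions (A :|: B) C = inversions A C :|: inversions B C.
  by apply/setP => p; rewrite !inE andb_orl.
rewrite cardsU (_ : _ :&: _ = set0) ?cards0 ?subn0 //.
apply/setP => p; rewrite !inE; apply/negbTE/negP.
case/andP=> /and3P[pA _ _] /and3P[pB _ _].
by move/pred0P: dAB => /(_ p.1); rewrite /= pA pB.
Qed.

(** Every pair in A x B is an inversion for exactly one of the two orders, disjointness excluding
    equal indices, so the two inversion counts add up to [#|A| * #|B|]. *)
Lemma gsignC A B : [disjoint A & B] ->
  gsign R A B = (-1) ^+ (#|A| * #|B|) * gsign R B A.
Proof.
move=> dAB; rewrite !gsign_inversions -exprD.
pose sw := fun p : 'I_N * 'I_N => (p.2, p.1).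
have swK : involutive sw by case.
have cardAB : (#|A| * #|B| = #|inversions A B| + #|inversions B A|)%N.
  rewrite -(card_imset (inversions B A) (inv_inj swK)) -cardsX.
  have -> : setX A B = inversions A B :|: (sw @: inversions B A).
    apply/setP => -[a b]; rewrite !inE /=.
    rewrite -[(a, b)]swK mem_imset ?inE /=; last exact: inv_inj.
    case aA: (a \in A) => //=; case bB: (b \in B) => //=.
    case: ltngtP => // /val_inj eab.
    by move/pred0P: dAB => /(_ a); rewrite /= aA -eab bB.
  rewrite cardsU (_ : _ :&: _ = set0) ?cards0 ?subn0 //.
  apply/setP => -[a b]; rewrite !inE /=; apply/negbTE/negP.
  case/andP => /and3P[_ _ ab].
  rewrite -[(a, b)]swK mem_imset ?inE /=; last exact: inv_inj.
  by case/and3P => _ _; rewrite ltnNge (ltnW ab).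
rewrite cardAB -addnA addnn -signr_odd -[RHS]signr_odd oddD odd_double addbF.
by [].
Qed.

Lemma gsign0l A : gsign R set0 A = 1.
Proof.
rewrite gsign_inversions (_ : inversions _ _ = set0) ?cards0 //.
by apply/setP => p; rewrite !inE.
Qed.

Lemma gsign0r A : gsign R A set0 = 1.
Proof.
rewrite gsign_inversions (_ : inversions _ _ = set0) ?cards0 //.
by apply/setP => p; rewrite !inE andbF.
Qed.

Lemma normr_gsign A B : `|gsign R A B| = 1.
Proof. by rewrite normrX normrN1 expr1n. Qed.

Definition galg : Type := grass R N.
HB.instance Definition _ := GRing.Zmodule.copy galg {ffun {set 'I_N} -> R}.

Lemma galgD (x y : galg) S : (x + y) S = x S + y S. Proof. exact: ffunE. Qed.
Lemma galgN (x : galg) S : (- x) S = - x S. Proof. exact: ffunE. Qed.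
Lemma galg0 S : (0 : galg) S = 0. Proof. exact: ffunE. Qed.

Definition gone : galg := gconst N 1.
Definition gtimes (x y : galg) : galg := gmul x y.

Lemma gtimesE (x y : galg) S : gtimes x y S =
  \sum_(A : {set 'I_N} | A \subset S) gsign R A (S :\: A) * x A * y (S :\: A).
Proof. by rewrite /gtimes /gmul ffunE. Qed.

(** Both sides become sums over ordered partitions of S into A, B, C: the outer index on the right
    is substituted as [A :|: B], and the signs agree because [gsign] is multiplicative over disjoint
    unions in each argument. *)
Lemma gtimesA : associative gtimes.
Proof.
move=> x y z; apply/ffunP => S; rewrite !gtimesE.
under eq_bigr => A AS do rewrite gtimesE mulr_sumr.
under [RHS]eq_bigr => D DS do rewrite gtimesE mulr_sumr mulr_suml.
rewrite [RHS](exchange_big_dep (fun A => A \subset S)) /=; last first.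
  by move=> D A DS AD; apply: subset_trans DS.
apply: eq_bigr => A AS.
rewrite [RHS](reindex_onto (fun B => A :|: B) (fun D => D :\: A)) /=; last first.
  by move=> D /andP[_ AD]; rewrite -[RHS](setID D A) (setIidPr AD).
apply: eq_big => [B|B BSA].
  rewrite subsetUl andbT subUset AS /= subsetD.
  rewrite setDUl setDv set0U; congr (_ && _).
  by apply/idP/eqP => [/setDidPl|/setDidPl].
have dAB : [disjoint A & B].
  by move: BSA; rewrite subsetD disjoint_sym => /andP[].
have BS : B \subset S by move: BSA; rewrite subsetD => /andP[].
have -> : (A :|: B) :\: A = B.
  by rewrite setDUl setDv set0U; apply/setDidPl; rewrite disjoint_sym.
rewrite -setDDl; set C := (S :\: A) :\: B.
have SA : S :\: A = B :|: C by rewrite -[LHS](setID _ B) (setIidPr BSA).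
have dBC : [disjoint B & C].
  by rewrite disjoint_sym; apply/setDidPl; rewrite /C setDDl setUid.
rewrite SA gsignUr // gsignUl //; ring.
Qed.

Lemma gtimes1x : left_id gone gtimes.
Proof.
move=> x; apply/ffunP => S; rewrite gtimesE (bigD1 set0) ?sub0set //= big1 => [|A].
  by rewrite setD0 gsign0l /gone ffunE eqxx addr0 !mul1r.
by case/andP=> _ /negbTE A0; rewrite /gone ffunE A0 mulr0 mul0r.
Qed.

Lemma gtimesx1 : right_id gone gtimes.
Proof.
move=> x; apply/ffunP => S; rewrite gtimesE (bigD1 S) //= big1 => [|A].
  by rewrite setDv gsign0r /gone ffunE eqxx addr0 mul1r mulr1.
case/andP=> AS nAS; rewrite /gone ffunE ifF ?mulr0 // setD_eq0.
by apply: contraNF nAS => SA; rewrite eqEsubset AS.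
Qed.

Lemma gtimesDl : left_distributive gtimes +%R.
Proof.
move=> x y z; apply/ffunP => S; rewrite galgD !gtimesE -big_split /=.
by apply: eq_bigr => A _; rewrite galgD mulrDr mulrDl.
Qed.

Lemma gtimesDr : right_distributive gtimes +%R.
Proof.
move=> x y z; apply/ffunP => S; rewrite galgD !gtimesE -big_split /=.
by apply: eq_bigr => A _; rewrite galgD mulrDr.
Qed.

Lemma gone_neq0 : gone != 0.
Proof.
apply/eqP => /ffunP /(_ set0); rewrite !ffunE eqxx; exact/eqP/oner_neq0.
Qed.

HB.instance Definition _ := GRing.Zmodule_isNzRing.Build galg
  gtimesA gtimes1x gtimesx1 gtimesDl gtimesDr gone_neq0.

Lemma mulgE (x y : galg) S : (x * y) S =
  \sum_(A : {set 'I_N} | A \subset S) gsign R A (S :\: A) * x A * y (S :\: A).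
Proof. exact: gtimesE. Qed.

Definition gevenb : {pred galg} :=
  fun x : galg => [forall S : {set 'I_N}, odd #|S| ==> (x S == 0)].

Lemma gevenbP (x : galg) : reflect (geven x) (x \in gevenb).
Proof.
apply: (iffP forallP) => [xe S oS|xe S]; last by apply/implyP => /xe ->.
by apply/eqP/(implyP (xe S)).
Qed.

Lemma odd_cardD A S : A \subset S -> odd #|S :\: A| = odd #|S| (+) odd #|A|.
Proof. by move=> AS; rewrite -(cardsID A S) (setIidPr AS) oddD addbC addbA addbb. Qed.

Lemma gevenb_subring : subring_closed gevenb.
Proof.
split.
- apply/gevenbP => S oS; rewrite ffunE ifF //.
  by apply: contraTF oS => /eqP ->; rewrite cards0.
- move=> x y /gevenbP xe /gevenbP ye; apply/gevenbP => S oS.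
  by rewrite galgD galgN xe // ye // subr0.
- move=> x y /gevenbP xe /gevenbP ye; apply/gevenbP => S oS.
  rewrite mulgE big1 // => A AS.
  case oA: (odd #|A|); first by rewrite xe // mulr0 mul0r.
  by rewrite ye ?mulr0 // odd_cardD // oS oA.
Qed.

HB.instance Definition _ := GRing.isSubringClosed.Build galg gevenb gevenb_subring.

(** Even elements commute, so lambda-lengths and products of two mu-invariants live in a commutative
    ring where [ring] applies. *)
Record evalg := EvAlg { evval :> galg; _ : evval \in gevenb }.
HB.instance Definition _ := [isSub for evval].
HB.instance Definition _ := [Choice of evalg by <:].
HB.instance Definition _ := [SubChoice_isSubNzRing of evalg by <:].

(** Exchanging A with its complement in S matches the two sums; the sign is 1 wherever the even
    factor has a nonzero coefficient. *)
Lemma geven_comm (x y : galg) : geven x -> x * y = y * x.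
Proof.
move=> xe; apply/ffunP => S; rewrite !mulgE.
rewrite (reindex_onto (fun A => S :\: A) (fun A => S :\: A)) /=; last first.
  by move=> A AS; rewrite setDDr setDv set0U; apply/setIidPr.
apply: eq_big => [A|A /andP[_ /eqP AS]].
  rewrite subsetDl /= setDDr setDv set0U.
  by apply/eqP/idP => [<-|/setIidPr //]; rewrite subsetIl.
rewrite AS gsignC; last by apply/setDidPl; rewrite setDDl setUid.
rewrite -signr_odd oddM.
case oA: (odd #|S :\: A|); first by rewrite (xe _ oA) !(mulr0, mul0r).
by rewrite /= mul1r -!mulrA [x _ * _]mulrC.
Qed.

Lemma godd_anticomm (x y : galg) : godd x -> godd y -> x * y = - (y * x).
Proof.
move=> xo yo; apply/ffunP => S; rewrite galgN !mulgE -sumrN.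
rewrite (reindex_onto (fun A => S :\: A) (fun A => S :\: A)) /=; last first.
  by move=> A AS; rewrite setDDr setDv set0U; apply/setIidPr.
apply: eq_big => [A|A /andP[_ /eqP AS]].
  rewrite subsetDl /= setDDr setDv set0U.
  by apply/eqP/idP => [<-|/setIidPr //]; rewrite subsetIl.
rewrite AS gsignC; last by apply/setDidPl; rewrite setDDl setUid.
rewrite -signr_odd oddM.
case oB: (odd #|S :\: A|); last by rewrite (xo _ (negbT oB)) !(mulr0, mul0r) oppr0.
case oA: (odd #|A|); last by rewrite (yo _ (negbT oA)) !(mulr0, mul0r) oppr0.
by rewrite /= expr1; ring.
Qed.

Lemma evalg_mulC : commutative (@GRing.mul evalg).
Proof.
move=> x y; apply: val_inj; apply: geven_comm.
by apply/gevenbP; exact: valP.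
Qed.
HB.instance Definition _ := GRing.PzRing_hasCommutativeMul.Build evalg evalg_mulC.

End GrassmannRing.

(** * Weighted norms *)

Section GrassmannNorm.
Variables (R : realType) (N : nat).
Local Notation galg := (galg R N).
Local Notation evalg := (evalg R N).
Implicit Types (A B S : {set 'I_N}) (x y z : galg) (t : R).

Lemma galgB x y S : (x - y) S = x S - y S.
Proof. by rewrite galgD galgN. Qed.

Lemma galg1 S : (1 : galg) S = (S == set0)%:R.
Proof. by rewrite [LHS]ffunE; case: eqP. Qed.

Definition gbody x : R := body x.

Lemma bodyM x y : gbody (x * y) = gbody x * gbody y.
Proof.
rewrite /gbody /body mulgE (big_pred1 set0) => [|A]; last by rewrite subset0.
by rewrite setD0 gsign0l mul1r.
Qed.

(** The weight is multiplicative on disjoint index sets, which keeps the norm submultiplicative,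
    while a small [t] makes the soul negligible. At [t = 1] this is the usual norm. *)
Definition wnorm t x : R := \sum_(S : {set 'I_N}) `|x S| * t ^+ #|S|.

Lemma wnorm_ge0 t x : 0 <= t -> 0 <= wnorm t x.
Proof. by move=> t0; apply: sumr_ge0 => S _; rewrite mulr_ge0 ?exprn_ge0. Qed.

Lemma wnormD t x y : 0 <= t -> wnorm t (x + y) <= wnorm t x + wnorm t y.
Proof.
move=> t0; rewrite /wnorm -big_split /=; apply: ler_sum => S _.
by rewrite -mulrDl ler_wpM2r ?exprn_ge0 // galgD ler_normD.
Qed.

Lemma wnormN t x : wnorm t (- x) = wnorm t x.
Proof. by apply: eq_bigr => S _; rewrite galgN normrN. Qed.

Lemma wnormM t x y : 0 <= t -> wnorm t (x * y) <= wnorm t x * wnorm t y.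
Proof.
move=> t0; pose f A B : R := `|x A| * t ^+ #|A| * (`|y B| * t ^+ #|B|).
have f0 A B : 0 <= f A B by rewrite !mulr_ge0 ?exprn_ge0.
have -> : wnorm t x * wnorm t y = \sum_A \sum_B f A B.
  by rewrite mulr_suml; apply: eq_bigr => A _; rewrite mulr_sumr.
apply: (@le_trans _ _ (\sum_(S : {set 'I_N}) \sum_(A : {set 'I_N} | A \subset S) f A (S :\: A))).
  apply: ler_sum => S _; rewrite mulgE.
  apply: le_trans (ler_wpM2r (exprn_ge0 _ t0) (ler_norm_sum _ _ _)) _.
  rewrite mulr_suml; apply: ler_sum => A AS.
  rewrite !normrM normr_gsign mul1r /f.
  rewrite -(cardsID A S) (setIidPr AS) exprD le_eqVlt; apply/orP; left.
  by apply/eqP; ring.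
rewrite (exchange_big_dep xpredT) //=; apply: ler_sum => A _.
rewrite (reindex_onto (fun B => A :|: B) (fun S => S :\: A)) /=; last first.
  by move=> S AS; rewrite -[RHS](setID S A) (setIidPr AS).
rewrite big_mkcond /=; apply: ler_sum => B _; case: ifP => // /andP[_ /eqP ->].
by [].
Qed.

Lemma ler_wnormM t x y (a b : R) : 0 <= t -> wnorm t x <= a -> wnorm t y <= b ->
  wnorm t (x * y) <= a * b.
Proof.
move=> t0 xa yb; apply: le_trans (wnormM x y t0) _.
by rewrite ler_pM ?wnorm_ge0.
Qed.

Lemma wnorm_body1 t x : gbody x = 1 -> wnorm t x = 1 + wnorm t (x - 1).
Proof.
rewrite /gbody /body => x1; rewrite /wnorm (bigD1 set0) //= [in RHS](bigD1 set0) //=.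
rewrite galgB galg1 eqxx x1 subrr normr0 mul0r add0r normr1 cards0 mulr1.
by congr (_ + _); apply: eq_bigr => S /negbTE S0; rewrite galgB galg1 S0 subr0.
Qed.

Lemma wnorm_body0_le t z : 0 <= t <= 1 -> gbody z = 0 -> wnorm t z <= t * wnorm 1 z.
Proof.
move=> /andP[t0 t1] z0; rewrite /wnorm mulr_sumr; apply: ler_sum => S _.
have [->|S0] := eqVneq S set0; first by rewrite [z set0]z0 normr0 !mul0r mulr0.
rewrite expr1n mulr1 mulrC ler_wpM2r // -[leRHS]expr1.
by rewrite ler_wiXn2l // card_gt0.
Qed.

(** Degrees are at most N, so undoing the weight costs only a constant factor. *)
Lemma wnorm1_le t x : 0 < t <= 1 -> wnorm 1 x <= t ^- N * wnorm t x.
Proof.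
move=> /andP[t0 t1]; rewrite /wnorm mulr_sumr; apply: ler_sum => S _.
rewrite expr1n mulr1 mulrCA ler_peMr // ler_pdivlMl ?exprn_gt0 // mulr1.
by rewrite (ler_wiXn2l (ltW t0)) // -[leqRHS]card_ord max_card.
Qed.

Definition vanishes_below k x := forall S, (#|S| < k)%N -> x S = 0.

Lemma vanishes_belowM i j x y : vanishes_below i x -> vanishes_below j y ->
  vanishes_below (i + j) (x * y).
Proof.
move=> xi yj S Sij; rewrite mulgE big1 // => A AS.
have [Ai|iA] := ltnP #|A| i; first by rewrite xi // mulr0 mul0r.
rewrite yj ?mulr0 // cardsD (setIidPr AS).
by move: (subset_leq_card AS) Sij iA; lia.
Qed.

(** Each factor raises the lowest degree present by at least one, and no degree exceeds N. *)
Lemma body0_nilpotent z : gbody z = 0 -> z ^+ N.+1 = 0.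
Proof.
move=> z0; have zk k : vanishes_below k (z ^+ k).
  elim: k => [|k IH]; first by [].
  rewrite exprS -add1n; apply: vanishes_belowM => // S.
  by rewrite ltnS leqn0 cards_eq0 => /eqP ->.
apply/ffunP => S; rewrite zk ?galg0 //.
by rewrite ltnS -[leqRHS]card_ord max_card.
Qed.

(** Geometric series in the nilpotent element 1 - x. *)
Lemma even_inverse (x : evalg) : gbody x = 1 -> exists y : evalg, x * y = 1.
Proof.
move=> x1; pose z := 1 - x; exists (\sum_(i < N.+1) z ^+ i).
have -> : x = - (z - 1) by rewrite /z opprB subKr.
rewrite mulNr -subrX1 opprB.
suff -> : z ^+ N.+1 = 0 by rewrite subr0.
apply: val_inj; rewrite rmorphXn /=; apply: body0_nilpotent.
by rewrite /gbody /body galgB galg1 eqxx [evval x set0]x1 subrr.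
Qed.

Lemma gconst_even (c : R) : (gconst N c : galg) \in @gevenb R N.
Proof.
by apply/gevenbP => S oS; rewrite ffunE ifF //; apply: contraTF oS => /eqP ->; rewrite cards0.
Qed.

Definition cst (c : R) : evalg := EvAlg (gconst_even c).

Lemma cst_mulE c (x : galg) S : (evval (cst c) * x) S = c * x S.
Proof.
rewrite mulgE (bigD1 set0) ?sub0set //= big1 ?addr0.
  by rewrite setD0 gsign0l mul1r ffunE eqxx.
by move=> A /andP[_ /negbTE A0]; rewrite ffunE A0 mulr0 mul0r.
Qed.

Lemma cst_is_zmod_morphism : zmod_morphism cst.
Proof.
move=> a b; apply: val_inj; apply/ffunP => S.
by rewrite rmorphB /= galgB !ffunE; case: ifP; rewrite ?subr0.
Qed.

Lemma cst_is_monoid_morphism : monoid_morphism cst.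
Proof.
split=> [|a b]; apply: val_inj; apply/ffunP => S.
  by rewrite [LHS]ffunE [RHS]galg1; case: eqP.
by rewrite rmorphM /= cst_mulE !ffunE; case: ifP; rewrite ?mulr0.
Qed.

HB.instance Definition _ := GRing.isZmodMorphism.Build R evalg cst cst_is_zmod_morphism.
HB.instance Definition _ := GRing.isMonoidMorphism.Build R evalg cst cst_is_monoid_morphism.

Definition ewnorm t (x : evalg) : R := wnorm t x.
Definition ebody (x : evalg) : R := gbody x.

Lemma ewnorm_ge0 t (x : evalg) : 0 <= t -> 0 <= ewnorm t x.
Proof. exact: wnorm_ge0. Qed.

Lemma ewnormD t (x y : evalg) : 0 <= t -> ewnorm t (x + y) <= ewnorm t x + ewnorm t y.
Proof. exact: wnormD. Qed.

Lemma ewnormN t (x : evalg) : ewnorm t (- x) = ewnorm t x.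
Proof. exact: wnormN. Qed.

Lemma ler_ewnormM t (x y : evalg) (a b : R) : 0 <= t -> ewnorm t x <= a -> ewnorm t y <= b ->
  ewnorm t (x * y) <= a * b.
Proof. exact: ler_wnormM. Qed.

Lemma ewnorm_cstM t c (x : evalg) : ewnorm t (cst c * x) = `|c| * ewnorm t x.
Proof.
rewrite /ewnorm /wnorm mulr_sumr; apply: eq_bigr => S _.
by rewrite cst_mulE normrM mulrA.
Qed.

Lemma ebody_cst c : ebody (cst c) = c.
Proof. by rewrite /ebody /gbody /body ffunE eqxx. Qed.

Lemma ebodyM (x y : evalg) : ebody (x * y) = ebody x * ebody y.
Proof. exact: bodyM. Qed.

Lemma ebody1 : ebody 1 = 1.
Proof. by rewrite /ebody /gbody /body [LHS]galg1 eqxx. Qed.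

Lemma ebodyB (x y : evalg) : ebody (x - y) = ebody x - ebody y.
Proof. exact: galgB. Qed.

Lemma ewnorm_body1 t (x : evalg) : ebody x = 1 -> ewnorm t x = 1 + ewnorm t (x - 1).
Proof. exact: wnorm_body1. Qed.

Lemma ewnorm_body0_le t (z : evalg) : 0 <= t <= 1 -> ebody z = 0 -> ewnorm t z <= t * ewnorm 1 z.
Proof. exact: wnorm_body0_le. Qed.

End GrassmannNorm.

(** * Elements bounded together with their inverses *)

Section Size.
Variables (R : realType) (N : nat).
Local Notation evalg := (evalg R N).
Implicit Types (x y z g h : evalg) (t k : R).

(** Inverses are tracked as well because the recursion for the defect contains U = (e G(y))^-1. *)
Definition esize t g k := exists h, [/\ g * h = 1, ewnorm t g <= k & ewnorm t h <= k].

Lemma esizeM t x y (a b : R) : 0 <= t -> esize t x a -> esize t y b ->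
  esize t (x * y) (a * b).
Proof.
move=> t0 [x' [xx' xa x'a]] [y' [yy' yb y'b]]; exists (x' * y'); split.
- by rewrite mulrACA xx' yy' mulr1.
- exact: ler_ewnormM.
- exact: ler_ewnormM.
Qed.

Lemma esize_le t g (a b : R) : a <= b -> esize t g a -> esize t g b.
Proof. by move=> ab [h [gh ga ha]]; exists h; split; rewrite ?(le_trans ga) ?(le_trans ha). Qed.

Lemma esize_near1 t g (f : R) : 0 <= t -> ebody g = 1 -> ewnorm t (g - 1) <= f ->
  f <= 1 / 2 -> esize t g (expR (2 * f)).
Proof.
move=> t0 g1 gf f2; have [h gh] := even_inverse g1.
have f0 : 0 <= f by apply: le_trans gf; exact: ewnorm_ge0.
have h1 : ebody h = 1 by rewrite -[LHS]mul1r -g1 -ebodyM gh ebody1.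
have e1 : 1 + 2 * f <= expR (2 * f) by exact: expR_ge1Dx.
exists h; split=> //; first by rewrite ewnorm_body1 //; lra.
(* The inverse satisfies |h| <= 1 + f |h|, whence |h| <= 1 / (1 - f) <= exp(2 f), as f <= 1/2. *)
have hE : h - 1 = - ((g - 1) * h) by rewrite mulrBl gh mul1r opprB.
have hn : ewnorm t (h - 1) <= f * ewnorm t h by rewrite hE ewnormN ler_ewnormM.
have hB := ewnorm_body1 t h1.
have h2 : ewnorm t h * (1 - f) <= 1 by lra.
have ff : f * f <= f * (1 / 2) by rewrite ler_wpM2l.
have h0 : 0 <= ewnorm t h by exact: ewnorm_ge0.
have : 1 <= expR (2 * f) * (1 - f) by nra.
nra.
Qed.

Lemma ewnorm_body0_small z (w : R) : ebody z = 0 -> 0 < w ->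
  exists2 t0, 0 < t0 <= 1 & forall t, 0 < t <= t0 -> ewnorm t z <= w.
Proof.
move=> z0 w0; have n0 : 0 <= ewnorm 1 z by exact: ewnorm_ge0.
pose q := 1 + ewnorm 1 z.
have q0 : 0 < q by rewrite /q; lra.
exists (Num.min 1 (w / q)); first by rewrite lt_min ltr01 divr_gt0 //= ge_min lexx.
move=> t /andP[t0]; rewrite le_min => /andP[t1]; rewrite ler_pdivlMr // => tw.
apply: le_trans (ewnorm_body0_le _ z0) _; first by rewrite (ltW t0).
by apply: le_trans tw; rewrite ler_wpM2l ?(ltW t0) // /q; lra.
Qed.

Lemma esize_small g k : ebody g = 1 -> 1 < k ->
  exists2 t0, 0 < t0 <= 1 & forall t, 0 < t <= t0 -> esize t g k.
Proof.
move=> g1 k1; have [h gh] := even_inverse g1.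
have h1 : ebody h = 1 by rewrite -[LHS]mul1r -g1 -ebodyM gh ebody1.
have k0 : 0 < k - 1 by lra.
have [tg /andP[tg0 tg1] Hg] : exists2 t0, 0 < t0 <= 1 &
    forall t, 0 < t <= t0 -> ewnorm t (g - 1) <= k - 1.
  by apply: ewnorm_body0_small => //; rewrite ebodyB g1 ebody1 subrr.
have [th /andP[th0 th1] Hh] : exists2 t0, 0 < t0 <= 1 &
    forall t, 0 < t <= t0 -> ewnorm t (h - 1) <= k - 1.
  by apply: ewnorm_body0_small => //; rewrite ebodyB h1 ebody1 subrr.
exists (Num.min tg th); first by rewrite lt_min tg0 th0 /= ge_min tg1.
move=> t /andP[t0]; rewrite le_min => /andP[ttg tth].
by exists h; split=> //; rewrite ewnorm_body1 // -lerBrDl; [apply: Hg|apply: Hh]; rewrite t0.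
Qed.

End Size.

(** The letters [ga], [gb], [gc], [gd] stand for the factors of body 1 of x, y, x+y, 2x+y, and [p],
    [b], [q], [d] for their bodies. Since [u * gc = ga] and [gc * hb = e * ga], dividing the Ptolemy
    relation by [b * gb] exposes the common factor [e * ga * gc]. *)
Lemma ptolemy_normal_form (A : comNzRingType)
  (ga gb gc gd hb e e' w p q d b al s : A) :
  gb * hb = 1 -> e * e' = 1 -> gc = e * ga * gb ->
  d * b = p ^+ 2 + q ^+ 2 -> al * (p ^+ 2 + q ^+ 2) = 1 ->
  (d * gd) * (b * gb) =
    (p * ga) * (p * ga) + (q * gc) * (q * gc) + s * ((p * ga) * (q * gc) * w) ->
  let u := e' * hb in
  gd = (1 + al * (p ^+ 2 * (u ^+ 2 - 1) + s * p * q * u * w)) * e * ga * gc.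
Proof.
move=> gbK eK gcE db alK pt u; rewrite {}/u.
have -> : gd = al * ((d * gd) * (b * gb)) * hb.
  transitivity (al * (d * b) * gd * (gb * hb)); last by ring.
  by rewrite db alK gbK mulr1 mul1r.
have -> : 1 + al * (p ^+ 2 * ((e' * hb) ^+ 2 - 1) + s * p * q * (e' * hb) * w) =
   al * (q ^+ 2 + p ^+ 2 * (e' * hb) ^+ 2 + s * p * q * (e' * hb) * w).
  by rewrite -{1}alK; ring.
rewrite pt gcE.
have E1 : (e' * hb) * (e * ga * gb) = ga.
  transitivity (e * e' * (gb * hb) * ga); first by ring.
  by rewrite eK gbK !mul1r.
have -> : al * (q ^+ 2 + p ^+ 2 * (e' * hb) ^+ 2 + s * p * q * (e' * hb) * w) * e * ga * (e * ga * gb)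
  = al * (q ^+ 2 * (e * ga * (e * ga * gb)) + p ^+ 2 * (e * ga) * (e' * hb) * ((e' * hb) * (e * ga * gb))
     + s * p * q * w * (e * ga) * ((e' * hb) * (e * ga * gb))) by ring.
rewrite E1.
have E2 : (e * ga) * (e' * hb) * ga = (e * e') * hb * ga * ga by ring.
rewrite -!(mulrA (p ^+ 2)) E2 eK.
have -> : al * (p * ga * (p * ga) + q * (e * ga * gb) * (q * (e * ga * gb)) + s * (p * ga * (q * (e * ga * gb)) * w)) * hb
 = al * (p ^+ 2 * ga ^+ 2 * hb + (gb * hb) * (q ^+ 2 * (e * ga * (e * ga * gb)) + s * p * q * w * (e * ga) * ga)) by ring.
by rewrite gbK; ring.
Qed.

(** * Real estimates for the Gronwall argument *)

Section RealEstimates.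
Variable R : realType.
Implicit Types (u k w th L s : R).

(** This will bound the norm of F - 1, with [u] the ratio of bodies and [expR (th * L)] a bound for
    the norm of U. With y = exp(-L/2), the growth E^2 is absorbed by one factor y because th <= 1/6,
    the factor L by y^2, and one y is left over. *)
Lemma perturbation_bound u w th L : 0 <= L -> 0 <= u <= expR (- L) ->
  0 < th <= 1 / 6 -> 0 <= w <= th ->
  u ^+ 2 * (expR (th * L) ^+ 2 - 1) + u * expR (th * L) * w
    <= 3 * th * expR (- L / 2).
Proof.
move=> L0 /andP[u0 uL] /andP[th0 th6] /andP[w0 wth].
set E := expR (th * L); set y := expR (- L / 2).
have th0' := ltW th0; have y0 : 0 <= y by exact: expR_ge0.
have yy : expR (- L) = y ^+ 2 by rewrite -expRM_natl; congr expR; lra.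
have E1 : 1 <= E by rewrite /E -expR0 ler_expR mulr_ge0.
have Ey : y * E ^+ 2 <= 1.
  by rewrite /y /E -expRM_natl -expRD -[leRHS]expR0 ler_expR; nra.
have E21 : E ^+ 2 - 1 <= 2 * th * L * E ^+ 2.
  have : 1 + - (2 * th * L) <= expR (- (2 * th * L)) by exact: expR_ge1Dx.
  have -> : expR (- (2 * th * L)) = (E ^+ 2)^-1.
    by rewrite expRN /E -expRM_natl; congr (expR _)^-1; ring.
  have E20 : 0 < E ^+ 2 by rewrite exprn_gt0 // /E expR_gt0.
  move=> H; have := ler_wpM2r (ltW E20) H; rewrite mulVf ?gt_eqF //; lra.
have Ly : y ^+ 2 * L <= 1.
  rewrite -yy expRN ler_pdivrMl ?expR_gt0 // mulr1.
  by apply: le_trans (expR_ge1Dx _); lra.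
have u2 : u ^+ 2 <= y ^+ 4.
  have -> : y ^+ 4 = (y ^+ 2) ^+ 2 by ring.
  by rewrite ler_sqr ?nnegrE ?exprn_ge0 // -yy.
have t1 : u ^+ 2 * (E ^+ 2 - 1) <= 2 * th * y.
  apply: (@le_trans _ _ (y ^+ 4 * (2 * th * L * E ^+ 2))).
    apply: ler_pM => //; first exact: exprn_ge0.
    by rewrite subr_ge0 exprn_ege1.
  have -> : y ^+ 4 * (2 * th * L * E ^+ 2) =
    2 * th * y * ((y ^+ 2 * L) * (y * E ^+ 2)) by ring.
  apply: ler_piMr; first by rewrite !mulr_ge0.
  by apply: mulr_ile1 => //; rewrite !mulr_ge0 ?exprn_ge0 // (le_trans _ E1).
have t2 : u * E * w <= th * y.
  apply: (@le_trans _ _ (y ^+ 2 * E ^+ 2 * th)).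
    apply: ler_pM => //; first by rewrite mulr_ge0 // (le_trans _ E1).
    apply: ler_pM => //; [by rewrite (le_trans _ E1)|by rewrite -yy|].
    by rewrite ler_eXnr.
  have -> : y ^+ 2 * E ^+ 2 * th = th * y * (y * E ^+ 2) by ring.
  by apply: ler_piMr => //; rewrite mulr_ge0.
lra.
Qed.

(** Chosen so that a drop of y (1 - exp(-s)) in the potential, times this constant, equals 6 y / s,
    the cost of one step of the recursion. *)
Definition Kexp s : R := 6 / (s * (1 - expR (- s))).
(** The growth exponent allowed at a Farey edge. It rises towards [th] as the arcs get longer, and
    this slack pays for the accumulated perturbations. *)
Definition theta th s (Lx Ly : R) : R :=
  th * expR (- (Kexp s * (expR (- Lx / 2) + expR (- Ly / 2)))).

Lemma Kexp_gt0 s : 0 < s -> 0 < Kexp s.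
Proof. by move=> s0; rewrite divr_gt0 // mulr_gt0 // subr_gt0 expR_lt1 oppr_lt0. Qed.

Lemma thetaC th s Lx Ly : theta th s Lx Ly = theta th s Ly Lx.
Proof. by rewrite /theta [expR (- Lx / 2) + _]addrC. Qed.

Lemma theta_gt0 th s Lx Ly : 0 < th -> 0 < theta th s Lx Ly.
Proof. by move=> th0; rewrite mulr_gt0 ?expR_gt0. Qed.

Lemma theta_le th s Lx Ly : 0 < th -> 0 < s -> theta th s Lx Ly <= th.
Proof.
move=> th0 s0; rewrite /theta -[leRHS]mulr1 ler_pM2l // expR_le1 oppr_le0.
by rewrite mulr_ge0 ?addr_ge0 ?expR_ge0 // (ltW (Kexp_gt0 s0)).
Qed.

(** A floor common to all edges: the norm of W is unchanged by flips, so it must be compared with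
    one number valid everywhere. *)
Lemma theta_ge th s Lx Ly : 0 < th -> 0 < s -> 0 <= Lx -> 0 <= Ly ->
  th * expR (- (Kexp s * 2)) <= theta th s Lx Ly.
Proof.
move=> th0 s0 x0 y0; rewrite /theta ler_pM2l // ler_expR lerN2 ler_pM2l ?Kexp_gt0 //.
have h L : 0 <= L -> expR (- L / 2) <= 1.
  by move=> L0; rewrite expR_le1 mulNr oppr_le0 divr_ge0.
by have := h _ x0; have := h _ y0; lra.
Qed.

(* Passing from the edge {x, y} to {x, x + y} drops y, and the potential
   exp(-Lx/2) + exp(-Ly/2) decreases by a fixed fraction of exp(-Ly/2). *)
Lemma theta_step th s Lx Ly Lc : 0 < th -> 0 < s -> 2 * s <= Lx -> Lx + Ly <= Lc ->
  theta th s Lx Ly + 6 * theta th s Lx Ly * expR (- Ly / 2) / s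
    <= theta th s Lx Lc.
Proof.
move=> th0 s0 sx xyc; have K0 := Kexp_gt0 s0.
set T := theta th s Lx Ly; have T0 : 0 < T by exact: theta_gt0.
set y := expR (- Ly / 2); have y0 : 0 < y by exact: expR_gt0.
set c := expR (- Lc / 2).
have cy : c <= y * expR (- s) by rewrite /c /y -expRD ler_expR; lra.
have -> : theta th s Lx Lc = T * expR (Kexp s * (y - c)).
  by rewrite /T /theta -mulrA -expRD; congr (_ * expR _); rewrite -/y -/c; ring.
have es : 0 < 1 - expR (- s) by rewrite subr_gt0 expR_lt1 oppr_lt0.
have Ky : 6 * y / s <= Kexp s * (y - c).
  apply: (@le_trans _ _ (Kexp s * (y * (1 - expR (- s))))).
    rewrite /Kexp le_eqVlt; apply/orP; left; apply/eqP; field.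
    by rewrite !gt_eqF.
  by rewrite ler_pM2l //; lra.
have e1 : 1 + Kexp s * (y - c) <= expR (Kexp s * (y - c)) by exact: expR_ge1Dx.
have -> : T + 6 * T * y / s = T * (1 + 6 * y / s) by ring.
by rewrite ler_pM2l //; lra.
Qed.

End RealEstimates.

(** * The Farey tree *)

Definition unimodular (x y : farc) : Prop := `|det x y| = 1.

Definition comb (p q : nat) (x y : farc) : farc :=
  (p%:Z * x.1 + q%:Z * y.1, p%:Z * x.2 + q%:Z * y.2).

Lemma paddC x y : padd x y = padd y x.
Proof. by rewrite /padd addrC [x.2 + _]addrC. Qed.

Lemma unimodularC x y : unimodular x y -> unimodular y x.
Proof. by rewrite /unimodular => <-; rewrite -normrN; congr `|_|; rewrite /det; ring. Qed.

Lemma unimodular_add x y : unimodular x y -> unimodular x (padd x y).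
Proof. by rewrite /unimodular => <-; congr `|_|; rewrite /det /padd /=; ring. Qed.

Lemma unimodular_neg x y : unimodular x y -> unimodular x (pneg y).
Proof. by rewrite /unimodular => <-; rewrite -normrN; congr `|_|; rewrite /det /=; ring. Qed.

Lemma padd_pneg_padd x y : padd x (pneg (padd x y)) = pneg y.
Proof. by case: x y => [x1 x2] [y1 y2]; rewrite /padd /pneg /=; congr pair; ring. Qed.

Lemma combC p q x y : comb p q x y = comb q p y x.
Proof. by rewrite /comb; congr pair; ring. Qed.

Lemma comb_sub p q x y : (q <= p)%N -> comb p q x y = comb (p - q) q x (padd x y).
Proof. by move=> qp; rewrite /comb /padd /= -!subzn //; congr pair; ring. Qed.

Lemma coprime_subl p q : (q <= p)%N -> coprime (p - q) q = coprime p q.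
Proof. move=> qp; rewrite -{2}(subnK qp) /coprime [in LHS]gcdnC [in RHS]gcdnC.
by rewrite gcdnDr. Qed.

(** Subtractive Euclidean algorithm: while q <= p, passing from (x, y) to (x, x+y) replaces p by p -
    q, and swapping restores the order, until (p, q) = (1, 0). *)
Lemma sector_ind (P : farc -> farc -> Prop) :
    (forall x y, P x y -> P x (padd x y)) -> (forall x y, P x y -> P y x) ->
  forall x y p q, P x y -> coprime p q -> exists z, P (comb p q x y) z.
Proof.
move=> Padd Psym x y p q; have [n] := ubnP (p + q); elim: n => // n IH in x y p q *.
wlog qp : p q x y / (q <= p)%N.
  move=> H pqn Pxy cpq; have [qp|/ltnW pq] := leqP q p; first exact: (H p q).
  by rewrite combC; apply: H; rewrite 1?addnC 1?coprime_sym //; apply: Psym.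
move=> pqn Pxy cpq; have [q0|q0] := posnP q.
  move: cpq; rewrite q0 /coprime gcdn0 => /eqP ->; exists y.
  by rewrite /comb !mul0r !mul1r !addr0 -surjective_pairing.
by rewrite comb_sub //; apply: IH; rewrite ?coprime_subl //; [lia|exact: Padd].
Qed.

(** * Recursion for lambda-lengths along the Farey tree *)

Section TorusData.
Variables (R : realType) (N : nat).
Local Notation evalg := (evalg R N).
Variables (Lam : farc -> evalg) (W : farc -> farc -> evalg).

Definition lbody x : R := ebody (Lam x).
Local Notation b := lbody.

(** The mu-invariants enter the estimates only through their product [W], so the odd variables are
    left behind here. The signs stay free at every flip because the norms do not see them. *)
Record torus_data : Prop := TorusData {
  td_pos : forall x y, unimodular x y -> 0 < b x;
  td_neg : forall x, Lam (pneg x) = Lam x;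
  td_ptolemy : forall x y, unimodular x y -> exists s : bool,
    Lam (padd x y) * Lam (padd x (pneg y)) =
      Lam x * Lam x + Lam y * Lam y + (-1) ^+ s * (Lam x * Lam y * W x y);
  td_flip : forall x y, unimodular x y -> exists s : bool,
    W x (padd x y) = (-1) ^+ s * W x y;
  td_sym : forall x y, unimodular x y -> W y x = W x y;
  td_W0 : forall x y, unimodular x y -> ebody (W x y) = 0 }.

Hypothesis td : torus_data.

Lemma ebodyD (x y : evalg) : ebody (x + y) = ebody x + ebody y.
Proof. exact: galgD. Qed.

Lemma td_next x y : unimodular x y -> exists s : bool,
  Lam (padd x (padd x y)) * Lam y =
    Lam x * Lam x + Lam (padd x y) * Lam (padd x y) +
    (-1) ^+ s * (Lam x * Lam (padd x y) * W x y).
Proof.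
move=> xy; have xc := unimodular_add xy.
have [s pt] := td_ptolemy td xc; have [s' ws] := td_flip td xy.
exists (s (+) s'); rewrite padd_pneg_padd (td_neg td) in pt.
rewrite pt ws signr_addb; congr (_ + _).
by rewrite -[RHS]mulrA; congr (_ * _); exact: mulrCA.
Qed.

Lemma lbody_next x y : unimodular x y ->
  b (padd x (padd x y)) * b y = b x ^+ 2 + b (padd x y) ^+ 2.
Proof.
move=> xy; have [s pt] := td_next xy.
rewrite /lbody -ebodyM pt !ebodyD !ebodyM (td_W0 td xy) !mulr0 addr0; ring.
Qed.

Lemma lbody_gt0l x y : unimodular x y -> 0 < b x.
Proof. exact: td_pos. Qed.

Lemma lbody_gt0r x y : unimodular x y -> 0 < b y.
Proof. by move/unimodularC; exact: td_pos. Qed.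

Lemma lbody_gt0_add x y : unimodular x y -> 0 < b (padd x y).
Proof. by move/unimodular_add; exact: lbody_gt0r. Qed.

Definition bounded_sector (delta : R) x y : Prop :=
  exists M : R, forall p q, coprime p q ->
    ewnorm 1 (Lam (comb p q x y)) <= M * b (comb p q x y) `^ (1 + delta).

Lemma bounded_sectorC delta x y : bounded_sector delta x y -> bounded_sector delta y x.
Proof.
by case=> M H; exists M => p q; rewrite coprime_sym combC; exact: H.
Qed.

(** For q <= p one has px + qy = (p-q)x + q(x+y), and symmetrically for p <= q, so every slope of
    the sector lies in one of the halves. *)
Lemma bounded_sector_split delta x y :
  bounded_sector delta x (padd x y) -> bounded_sector delta y (padd x y) ->
  bounded_sector delta x y.
Proof.
case=> M HM [M' HM']; exists (Num.max M M') => p q cpq; set z := comb p q x y.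
have [qp|/ltnW pq] := leqP q p.
  apply: (@le_trans _ _ (M * b z `^ (1 + delta))).
    by rewrite /z comb_sub //; apply: HM; rewrite coprime_subl.
  by rewrite ler_wpM2r ?powR_ge0 // le_max lexx.
apply: (@le_trans _ _ (M' * b z `^ (1 + delta))).
  rewrite /z combC comb_sub // [padd y x]paddC; apply: HM'.
  by rewrite coprime_subl // coprime_sym.
by rewrite ler_wpM2r ?powR_ge0 // le_max lexx orbT.
Qed.

(** This is the factor G(x) of body 1. *)
Definition unip x : evalg := cst N (b x)^-1 * Lam x.

Lemma Lam_unip x : 0 < b x -> Lam x = cst N (b x) * unip x.
Proof.
by move=> bx; rewrite mulrA -rmorphM mulfV ?gt_eqF // rmorph1 mul1r.
Qed.

Lemma ebody_unip x : 0 < b x -> ebody (unip x) = 1.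
Proof. by move=> bx; rewrite ebodyM ebody_cst mulVf // gt_eqF. Qed.

Lemma ewnorm_sign t (s : bool) (z : evalg) : ewnorm t ((-1) ^+ s * z) = ewnorm t z.
Proof. by case: s; rewrite ?expr1 ?mulN1r ?ewnormN ?expr0 ?mul1r. Qed.

End TorusData.

(** * Growth bound along a sector *)

Section SectorBound.
Variables (R : realType) (N : nat).
Local Notation evalg := (evalg R N).
Variables (Lam : farc -> evalg) (W : farc -> farc -> evalg).
Hypothesis td : torus_data Lam W.
Local Notation b := (lbody Lam).
Local Notation g := (unip Lam).

Variables (k s th t : R).
Hypotheses (k0 : 0 < k) (s0 : 0 < s) (th0 : 0 < th) (th6 : th <= 1 / 6) (t0 : 0 < t).

(** The constant [k] rescales the bodies so that these lengths can be super-additive on Farey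
    edges. *)
Definition loglen x : R := ln (k * b x).
Local Notation L := loglen.
Local Notation T x y := (theta th s (L x) (L y)).

(** Induction invariant along the tree. The reserve [- s] in the size bounds leaves room for the
    defect: the exponents of e, G(x), G(y) add up to T (L x + L y - s), which is at most T (L (x+y)
    - s). *)
Record controlled (x y : farc) : Prop := Controlled {
  ct_uni : unimodular x y;
  ct_lenl : 2 * s <= L x;
  ct_lenr : 2 * s <= L y;
  ct_super : L x + L y <= L (padd x y);
  ct_W : ewnorm t (W x y) <= th * expR (- (Kexp s * 2));
  ct_sizel : esize t (g x) (expR (T x y * (L x - s)));
  ct_sizer : esize t (g y) (expR (T x y * (L y - s)));
  ct_defect : exists e, [/\ g (padd x y) = e * g x * g y, ebody e = 1 &
                            esize t e (expR (s * T x y))] }.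

Lemma controlled_sym x y : controlled x y -> controlled y x.
Proof.
case=> xy lx ly lxy wxy sx sy [e [ge e1 se]].
have yx := unimodularC xy.
split; [exact: yx|exact: ly|exact: lx| | | | |].
- by rewrite addrC paddC.
- by rewrite (td_sym td xy).
- by rewrite thetaC; exact: sy.
- by rewrite thetaC; exact: sx.
- by exists e; rewrite thetaC paddC ge; split; [exact: mulrAC|exact: e1|exact: se].
Qed.

Lemma expR_loglen x : 0 < b x -> expR (L x) = k * b x.
Proof. by move=> bx; rewrite lnK // posrE mulr_gt0. Qed.

Lemma lbody_super x y : unimodular x y -> L x + L y <= L (padd x y) ->
  k * b x * b y <= b (padd x y).
Proof.
move=> xy; have bx := lbody_gt0l td xy; have by0 := lbody_gt0r td xy.
have bc := lbody_gt0_add td xy.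
move=> Lc; have : expR (L x + L y) <= expR (L (padd x y)) by rewrite ler_expR.
by rewrite expRD !expR_loglen // -mulrA ler_pM2l // mulrCA mulrA.
Qed.

Lemma ratio_le x y : unimodular x y -> L x + L y <= L (padd x y) ->
  b x / b (padd x y) <= expR (- L y).
Proof.
move=> xy Lc; have bx := lbody_gt0l td xy; have by0 := lbody_gt0r td xy.
have bc := lbody_gt0_add td xy.
rewrite expRN expR_loglen // ler_pdivrMr // ler_pdivlMl ?mulr_gt0 //.
have -> : k * b y * b x = k * b x * b y by ring.
exact: lbody_super.
Qed.

(** Combine k b(x) b(y) <= b(x+y) with b(2x+y) b(y) >= b(x+y)^2 and cancel b(y). *)
Lemma loglen_super_next x y : unimodular x y -> L x + L y <= L (padd x y) ->
  L x + L (padd x y) <= L (padd x (padd x y)).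
Proof.
move=> xy Lc; have H := lbody_super xy Lc; have xc := unimodular_add xy.
have bx := lbody_gt0l td xy; have by0 := lbody_gt0r td xy.
have bc := lbody_gt0_add td xy; have bd := lbody_gt0_add td xc.
rewrite -ler_expR expRD !expR_loglen // -mulrA ler_pM2l //.
rewrite -(ler_pM2r by0) (lbody_next td xy).
have : k * b x * b y * b (padd x y) <= b (padd x y) ^+ 2.
  by rewrite expr2 ler_pM2r.
have : 0 <= b x ^+ 2 by exact: sqr_ge0.
have -> : b x * (k * b (padd x y)) * b y = k * b x * b y * b (padd x y) by ring.
lra.
Qed.

(** F is the bracket of the normal form. Its distance from 1 is small because the ratio b(x) /
    b(x+y) <= exp(-L y) outweighs the moderate norm of U. *)
Lemma defect_next x y e E : controlled x y ->
  g (padd x y) = e * g x * g y -> ebody e = 1 ->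
  esize t e (expR (s * T x y)) -> E = expR (- L y / 2) ->
  exists F, [/\ g (padd x (padd x y)) = F * e * g x * g (padd x y), ebody F = 1 &
    esize t F (expR (6 * T x y * E))].
Proof.
move=> [xy lx ly Lc Wxy _ [hb [gbK _ nhb]] _] ge e1 [e' [eK _ ne']] ->.
have t0' := ltW t0; have xc := unimodular_add xy.
have bx := lbody_gt0l td xy; have by0 := lbody_gt0r td xy.
have bc := lbody_gt0_add td xy; have bd := lbody_gt0_add td xc.
set c := padd x y in ge Lc xc bc bd *; set d := padd x c in bd *.
have Tp : 0 < T x y by exact: theta_gt0.
have Tle : T x y <= th by exact: theta_le.
have ss : 0 <= 2 * s by rewrite mulr_ge0 // ltW.
have Lx0 : 0 <= L x by apply: le_trans lx.
have Ly0 : 0 <= L y by apply: le_trans ly.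
pose p := b x; pose q := b c; pose al := (p ^+ 2 + q ^+ 2)^-1.
have pq0 : 0 < p ^+ 2 + q ^+ 2 by rewrite addr_gt0 ?exprn_gt0.
have [sg pt] := td_next td xy.
(* The element U, built from the given inverses of e and G(y). *)
pose u := e' * hb.
pose F := 1 + cst N al * (cst N p ^+ 2 * (u ^+ 2 - 1)
                          + (-1) ^+ sg * cst N p * cst N q * u * W x y).
have gd : g d = F * e * g x * g c.
  apply: (@ptolemy_normal_form _ _ (g y) _ _ _ _ _ _ _ _ (cst N (b d)) (cst N (b y))) => //.
  - by rewrite -rmorphM (lbody_next td xy) rmorphD !expr2 !rmorphM.
  - by rewrite !expr2 -!rmorphM -rmorphD -rmorphM -!expr2 mulVf ?gt_eqF // rmorph1.
  - by rewrite -!Lam_unip.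
have by1 := ebody_unip by0.
have hb1 : ebody hb = 1 by rewrite -[LHS]mul1r -by1 -ebodyM gbK ebody1.
have e'1 : ebody e' = 1 by rewrite -[LHS]mul1r -e1 -ebodyM eK ebody1.
have u1 : ebody u = 1 by rewrite ebodyM hb1 e'1 mul1r.
have uu1 : ebody (u ^+ 2) = 1 by rewrite expr2 ebodyM u1 mul1r.
have FE : F - 1 = cst N (al * p ^+ 2) * (u ^+ 2 - 1)
                  + (-1) ^+ sg * (cst N (al * (p * q)) * (u * W x y)).
  rewrite /F addrAC subrr add0r mulrDr !expr2 !rmorphM mulrA; congr (_ + _).
  by rewrite -!mulrA mulrCA.
have F1 : ebody F = 1.
  apply/eqP; rewrite -subr_eq0 -[X in _ - X](@ebody1 R N) -ebodyB FE ebodyD.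
  rewrite !ebodyM ebodyB uu1 ebody1 subrr (td_W0 td xy) !mulr0 addr0.
  by [].
(* Up to sign, the coefficients of U^2 - 1 and U W in F - 1 are at most v^2 and v, where v is the
   ratio of the bodies of x and x+y. *)
set v := p / q; have v0 : 0 < v by rewrite divr_gt0.
have q0 : 0 < q by exact: bc.
have p0 : 0 < p by exact: bx.
have al0 : 0 < al by rewrite invr_gt0.
have alv2 : al * p ^+ 2 <= v ^+ 2.
  rewrite /al mulrC ler_pdivrMr // /v exprMn exprVn mulrDr.
  have -> : p ^+ 2 / q ^+ 2 * q ^+ 2 = p ^+ 2 by field; rewrite gt_eqF.
  by rewrite lerDr !mulr_ge0 ?invr_ge0 ?sqr_ge0 ?(ltW p0) ?(ltW q0).
have alv : al * (p * q) <= v.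
  rewrite /al mulrC ler_pdivrMr // /v mulrDr.
  have -> : p / q * q ^+ 2 = p * q by field; rewrite gt_eqF.
  by rewrite lerDr !mulr_ge0 ?invr_ge0 ?sqr_ge0 ?(ltW p0) ?(ltW q0).
set A := expR (T x y * L y).
(* The reserve cancels: s T + T (L y - s) = T L y. *)
have nu : ewnorm t u <= A.
  apply: (@le_trans _ _ (expR (s * T x y) * expR (T x y * (L y - s)))).
    exact: ler_ewnormM.
  by rewrite -expRD /A ler_expR; lra.
have A1 : 1 <= A by rewrite /A -expR0 ler_expR mulr_ge0 ?(ltW Tp).
have nuu : ewnorm t (u ^+ 2 - 1) <= A ^+ 2 - 1.
  by rewrite lerBrDl -ewnorm_body1 // !expr2 ler_ewnormM.
have W0 := ewnorm_ge0 (W x y) t0'.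
have nF : ewnorm t (F - 1) <= 3 * T x y * expR (- L y / 2).
  apply: le_trans (_ : v ^+ 2 * (A ^+ 2 - 1) + v * A * ewnorm t (W x y) <= _); last first.
    apply: perturbation_bound => //.
    - by rewrite (ltW v0) ratio_le.
    - by rewrite Tp (le_trans Tle).
    - by rewrite W0 (le_trans Wxy) // theta_ge.
  rewrite FE; apply: le_trans (ewnormD _ _ t0') _; rewrite ewnorm_sign !ewnorm_cstM.
  have alp0 : 0 <= al * p ^+ 2 by rewrite mulr_ge0 ?sqr_ge0 ?(ltW al0).
  have alpq0 : 0 <= al * (p * q) by rewrite ltW // !mulr_gt0.
  rewrite !ger0_norm //; apply: lerD; first by rewrite ler_pM ?ewnorm_ge0.
  by rewrite -mulrA ler_pM ?ewnorm_ge0 // ler_ewnormM.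
exists F; split=> //.
(* The requirement f <= 1/2 of [esize_near1] holds for f = 3 T exp(-L y / 2) because T <= th <=
   1/6. *)
have -> : 6 * T x y * expR (- L y / 2) = 2 * (3 * T x y * expR (- L y / 2)) by ring.
apply: esize_near1 => //.
have E1 : expR (- L y / 2) <= 1 by rewrite expR_le1 mulNr oppr_le0 divr_ge0.
have TE : T x y * expR (- L y / 2) <= T x y by rewrite ler_piMr // ltW.
move: TE Tle th6; rewrite -[3 * _ * _]mulrA; move: (T x y) (_ * _) => a c'; lra.
Qed.

(** The old bounds persist because the exponent increases, and by [theta_step] the increase covers
    the cost of the new factor F. *)
Lemma controlled_next x y : controlled x y -> controlled x (padd x y).
Proof.
move=> ctxy; have [xy lx ly Lc Wxy sx sy [e [ge e1 se]]] := ctxy.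
have xc := unimodular_add xy; have t0' := ltW t0.
have Tp : 0 < T x y by exact: theta_gt0.
have step := theta_step th0 s0 lx Lc.
have E0 := expR_ge0 (- L y / 2).
have TT' : T x y <= T x (padd x y).
  apply: le_trans step; rewrite lerDl; apply: divr_ge0; last exact: ltW.
  by apply: mulr_ge0 => //; apply: mulr_ge0 => //; exact: ltW.
have ss : 0 <= 2 * s by rewrite mulr_ge0 // ltW.
have lc : 2 * s <= L (padd x y).
  by apply: le_trans Lc; rewrite -[2 * s]addr0 lerD // (le_trans ss).
have s2 : s <= 2 * s by rewrite mulr_natl mulr2n lerDl ltW.
split; [exact: xc|exact: lx|exact: lc| | | | |].
- exact: loglen_super_next.
- by have [sg ->] := td_flip td xy; rewrite ewnorm_sign.
- by apply: esize_le sx; rewrite ler_expR ler_wpM2r // subr_ge0 (le_trans s2).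
- rewrite ge; apply: esize_le (esizeM t0' (esizeM t0' se sx) sy).
  rewrite -!expRD ler_expR.
  have -> : s * T x y + T x y * (L x - s) + T x y * (L y - s) =
    T x y * (L x + L y - s) by ring.
  apply: ler_pM; rewrite ?(ltW Tp) ?lerD2r //.
  by rewrite -addrA addr_ge0 ?(le_trans ss lx) // subr_ge0 (le_trans s2).
- have [F [gd F1 sF]] := defect_next ctxy ge e1 se erefl.
  exists (F * e); split; [exact: gd|by rewrite ebodyM F1 e1 mul1r|].
  (* Multiplied by s, [theta_step] reads s T + 6 T exp(-L y / 2) <= s T', with T' the exponent at
     {x, x+y}. *)
  apply: esize_le (esizeM t0' sF se); rewrite -expRD ler_expR.
  move: step; rewrite -(ler_pM2l s0) mulrDr.
  have -> : s * (6 * T x y * expR (- L y / 2) / s) = 6 * T x y * expR (- L y / 2).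
    by field; rewrite gt_eqF.
  by rewrite addrC.
Qed.

Lemma controlled_bound x y delta : th <= delta -> controlled x y ->
  ewnorm t (Lam x) <= b x * (k * b x) `^ delta.
Proof.
move=> thd [xy lx ly Lc Wxy [h [_ sx _]] _ _].
have bx := lbody_gt0l td xy.
rewrite (Lam_unip bx) ewnorm_cstM gtr0_norm // ler_pM2l //; apply: le_trans sx _.
rewrite -expR_loglen // -expRM ler_expR [L x * delta]mulrC.
have Tp : 0 < T x y by exact: theta_gt0.
have Tle : T x y <= th by exact: theta_le.
apply: ler_pM; first exact: ltW.
- by rewrite subr_ge0 (le_trans _ lx) // mulr_natl mulr2n lerDl ltW.
- exact: le_trans thd.
- by rewrite lerBlDr lerDl ltW.
Qed.

End SectorBound.

(** * Descent in the Markov tree *)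

Section Descent.
Variables (R : realType) (N : nat).
Local Notation evalg := (evalg R N).
Variables (Lam : farc -> evalg) (W : farc -> farc -> evalg).
Hypothesis td : torus_data Lam W.
Local Notation b := (lbody Lam).
Local Notation g := (unip Lam).

Lemma growing_sector delta x y : 0 < delta -> unimodular x y ->
  b x < b (padd x y) -> b y < b (padd x y) -> bounded_sector Lam delta x y.
Proof.
move=> delta0 xy bxc byc; set c := padd x y in bxc byc *.
have bx : 0 < b x by exact: lbody_gt0l td _ _ xy.
have by0 : 0 < b y by exact: lbody_gt0r td _ _ xy.
have bc : 0 < b c by exact: lbody_gt0_add td _ _ xy.
(* With this k the lengths are exactly additive on the initial edge, and L x = ln (b(x+y) / b(y)) >
   0 is the growth hypothesis; likewise for y. *)
pose k := b c / (b x * b y).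
have bxy : 0 < b x * b y by rewrite mulr_gt0.
have k0 : 0 < k by rewrite divr_gt0.
pose L := loglen Lam k.
have Lx0 : 0 < L x.
  rewrite ln_gt0 // /k -(ltr_pM2r by0) mul1r.
  have -> : b c / (b x * b y) * b x * b y = b c by field; rewrite !gt_eqF.
  by [].
have Ly0 : 0 < L y.
  rewrite ln_gt0 // /k -(ltr_pM2r bx) mul1r.
  have -> : b c / (b x * b y) * b y * b x = b c by field; rewrite !gt_eqF.
  by [].
have Lc : L x + L y <= L c.
  rewrite -ler_expR expRD !expR_loglen // le_eqVlt; apply/orP; left; apply/eqP.
  by rewrite /k; field; rewrite !gt_eqF.
pose s := Num.min (L x) (L y) / 2.
have s0 : 0 < s by rewrite divr_gt0 // lt_min Lx0 Ly0.
have s2 : 2 * s = Num.min (L x) (L y) by rewrite /s; field.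
have slx : 2 * s <= L x by rewrite s2 ge_min lexx.
have sly : 2 * s <= L y by rewrite s2 ge_min lexx orbT.
pose th : R := Num.min delta (1 / 6).
have th0 : 0 < th by rewrite lt_min delta0 divr_gt0.
have th6 : th <= 1 / 6 by rewrite ge_min lexx orbT.
have thd : th <= delta by rewrite ge_min lexx.
pose thm := th * expR (- (Kexp s * 2)).
have thm0 : 0 < thm by rewrite mulr_gt0 ?expR_gt0.
have thmT : thm <= theta th s (L x) (L y) by rewrite theta_ge // ltW.
have size1 : 1 < expR (s * thm) by rewrite expR_gt1 mulr_gt0.
have gx1 := ebody_unip bx; have gy1 := ebody_unip by0; have gc1 := ebody_unip bc.
have [hx hxK] := even_inverse gx1; have [hy hyK] := even_inverse gy1.
have hx1 : ebody hx = 1 by rewrite -[LHS]mul1r -{1}gx1 -ebodyM hxK ebody1.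
have hy1 : ebody hy = 1 by rewrite -[LHS]mul1r -{1}gy1 -ebodyM hyK ebody1.
(* The defect is forced by the equation G(x+y) = e G(x) G(y). *)
pose e := g c * (hx * hy).
have e1 : ebody e = 1 by rewrite ebodyM gc1 mul1r ebodyM hx1 hy1 mulr1.
have eE : g c = e * g x * g y.
  rewrite /e -[RHS]mulrA -[RHS]mulrA (mulrACA hx hy).
  by rewrite [hx * _]mulrC hxK [hy * _]mulrC hyK !mulr1.
have [tx /andP[tx0 tx1] Hx] := esize_small gx1 size1.
have [ty /andP[ty0 _] Hy] := esize_small gy1 size1.
have [te /andP[te0 _] He] := esize_small e1 size1.
have [tw /andP[tw0 _] Hw] := ewnorm_body0_small (td_W0 td xy) thm0.
(* One small t brings the sizes of G(x), G(y) and e, of body 1, below exp(s thm), and the norm of W,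
   of body 0, below thm. *)
pose t := Num.min (Num.min tx ty) (Num.min te tw).
have t0 : 0 < t by rewrite !lt_min tx0 ty0 te0 tw0.
have ttx : t <= tx by rewrite !ge_min lexx.
have tty : t <= ty by rewrite !ge_min lexx !orbT.
have tte : t <= te by rewrite !ge_min lexx !orbT.
have ttw : t <= tw by rewrite !ge_min lexx !orbT.
have sizeL u : 2 * s <= u -> expR (s * thm) <= expR (theta th s (L x) (L y) * (u - s)).
  move=> su; rewrite ler_expR mulrC; apply: ler_pM => //; try exact: ltW.
  by rewrite lerBrDr; apply: le_trans su; rewrite mulr_natl mulr2n.
have ct : controlled Lam W k s th t x y.
  split; [exact: xy|exact: slx|exact: sly|exact: Lc| | | |].
  - by apply: Hw; rewrite t0.
  - by apply: esize_le (sizeL _ slx) (Hx _ _); rewrite t0.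
  - by apply: esize_le (sizeL _ sly) (Hy _ _); rewrite t0.
  - exists e; split; [exact: eE|exact: e1|].
    apply: esize_le (He _ _); last by rewrite t0.
    by rewrite ler_expR ler_pM2l.
(* The first factor returns to the norm at t = 1, the second undoes the rescaling of the body. *)
exists (t ^- N * k `^ delta) => p q cpq; set z := comb p q x y.
have cn u v : controlled Lam W k s th t u v -> controlled Lam W k s th t u (padd u v).
  exact: controlled_next.
have cs u v : controlled Lam W k s th t u v -> controlled Lam W k s th t v u.
  exact: controlled_sym.
have [z' ctz] := sector_ind cn cs ct cpq.
rewrite -/z in ctz.
have bz : 0 < b z by exact: lbody_gt0l td _ _ (ct_uni ctz).
have t01 : 0 < t <= 1 by rewrite t0 (le_trans ttx).
apply: le_trans (wnorm1_le _ t01) _.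
rewrite -mulrA ler_pM2l ?invr_gt0 ?exprn_gt0 //.
apply: le_trans (controlled_bound td k0 s0 th0 thd ctz) _.
have -> : b z `^ (1 + delta) = b z * b z `^ delta.
  by rewrite powRD ?powRr1 ?(ltW bz) // (gt_eqF bz) implybT.
by rewrite powRM ?(ltW k0) ?(ltW bz) // mulrCA.
Qed.

(** The Markov-type equation of the bodies, whose constant [kap] is preserved by flips. *)
Definition markov (kap : R) x y : Prop :=
  b x ^+ 2 + b y ^+ 2 + b (padd x y) ^+ 2 = kap * b x * b y * b (padd x y).

(** Use A^2 + B^2 >= 2 A B and cancel A B. This keeps the bodies away from zero during the
    descent. *)
Lemma markov_ge (A B C kap : R) : 0 < A -> 0 < B -> 0 < C ->
  A ^+ 2 + B ^+ 2 + C ^+ 2 = kap * A * B * C -> 2 <= kap * C.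
Proof.
move=> A0 B0 C0 E; have AB : 0 < A * B by rewrite mulr_gt0.
rewrite -(ler_pM2r AB); have -> : kap * C * (A * B) = kap * A * B * C by ring.
by rewrite -E; have := sqr_ge0 (A - B); have := sqr_ge0 C; nra.
Qed.

Lemma markov_next kap x y : unimodular x y -> markov kap x y ->
  markov kap x (padd x y).
Proof.
move=> xy; have by0 := lbody_gt0r td xy; have D := lbody_next td xy.
rewrite /markov; move: D.
set d := padd x (padd x y); set c := padd x y; move: (b x) (b y) (b c) (b d) by0.
move=> A B C E B0 D M; apply: (mulfI (lt0r_neq0 B0)).
have -> : B * (kap * A * C * E) = (kap * A * B * C) * E by ring.
by rewrite -M -D; ring: D.
Qed.

(** Say D <= m with {m, n} = {A, C}. Then m B >= D B = m^2 + n^2, so B >= m + n^2 / m >= D + l^2 /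
    K, where l = 2 / kap bounds the bodies from below. Replacing B by D thus gains a fixed
    amount. *)
Lemma descent_gap (A B C D K eta kap : R) : 0 < A -> 0 < B -> 0 < C -> 0 < D -> 0 < K ->
  A <= K -> C <= K -> D * B = A ^+ 2 + C ^+ 2 -> D <= A \/ D <= C ->
  2 <= kap * A -> 2 <= kap * C -> 0 < kap -> eta = (2 / kap) ^+ 2 / K -> D + eta <= B.
Proof.
move=> A0 B0 C0 D0 K0 AK CK E DAC kA kC k0 ->.
have low (X : R) : 2 <= kap * X -> 2 / kap <= X by move=> H; rewrite ler_pdivrMr // mulrC.
have l0 : 0 < 2 / kap by rewrite divr_gt0.
have {kA}lA := low _ kA; have {kC}lC := low _ kC; move: (2 / kap) l0 lA lC => l l0 lA lC.
have aux (m n : R) : 0 < m -> 0 < n -> m <= K -> l <= n -> D <= m ->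
    D * B = m ^+ 2 + n ^+ 2 -> D + l ^+ 2 / K <= B.
  move=> m0 n0 mK ln Dm Emn.
  have h1 : m ^+ 2 + n ^+ 2 <= m * B by rewrite -Emn ler_pM2r.
  have h2 : l ^+ 2 / K <= n ^+ 2 / m.
    by rewrite ler_pM ?sqr_ge0 ?invr_ge0 ?(ltW K0) // ?lef_pV2 ?posrE // ler_sqr ?nnegrE ?(ltW n0) ?(ltW l0).
  have h3 : m + n ^+ 2 / m <= B.
    rewrite -(ler_pM2l m0); have -> : m * (m + n ^+ 2 / m) = m ^+ 2 + n ^+ 2.
      by field; rewrite gt_eqF.
    by [].
  lra.
by case: DAC => H; [apply: (aux A C)|apply: (aux C A)] => //; rewrite E addrC.
Qed.

(** Each descending flip lowers the sum of the three bodies by at least eta, so [n] bounds the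
    number of flips left, while [K] remains an upper bound for the bodies. *)
Lemma descent delta kap K eta n x y : 0 < delta -> 0 < kap -> 0 < K ->
    eta = (2 / kap) ^+ 2 / K -> unimodular x y -> markov kap x y ->
    b x <= K -> b y <= K -> b (padd x y) <= K ->
    b x + b y + b (padd x y) <= n%:R * eta ->
  bounded_sector Lam delta x y.
Proof.
move=> d0 kap0 K0 etaE; elim: n x y => [|n IH] x y xy.
  have bx := lbody_gt0l td xy; have by0 := lbody_gt0r td xy.
  have bc := lbody_gt0_add td xy; rewrite mul0r => _ _ _ _.
  by rewrite leNgt !addr_gt0.
wlog bxy : x y xy / b x <= b y.
  move=> H M xK yK cK S; have [/H|/ltW yx] := leP (b x) (b y); first exact.
  apply: bounded_sectorC; apply: H; rewrite ?[padd y x]paddC //.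
  - exact: unimodularC.
  - by move: M; rewrite /markov [padd y x]paddC => M; rewrite [_ + b x ^+ 2]addrC M; ring.
  - by rewrite [b y + _]addrC.
move=> M xK yK cK S.
have bx := lbody_gt0l td xy; have by0 := lbody_gt0r td xy.
have bc := lbody_gt0_add td xy.
have [cy|cy] := ltP (b y) (b (padd x y)).
  by apply: growing_sector => //; apply: le_lt_trans cy.
have xc := unimodular_add xy.
have yc : unimodular y (padd x y) by rewrite paddC; apply/unimodular_add/unimodularC.
(* Now y is a longest side. Flipping x gives b(x+2y) = (b(y)^2 + b(x+y)^2) / b(x) > b(y) >= b(x+y),
   so the half {y, x+y} is growing. *)
apply: bounded_sector_split; last first.
  have E := lbody_next td (unimodularC xy); rewrite [padd y x]paddC in E.
  apply: growing_sector => //; rewrite -(ltr_pM2r bx) E.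
    have : b y * b x <= b y * b y by rewrite ler_pM2l.
    by have := exprn_gt0 2 bc; rewrite -expr2; lra.
  have : b (padd x y) * b x <= b y * b y by rewrite ler_pM // ltW.
  by have := exprn_gt0 2 bc; rewrite -expr2; lra.
(* In the half {x, x+y} the side y is flipped: either 2x+y is longer than both x and x+y and the
   half is growing, or the sum drops by eta and the induction hypothesis applies. *)
have E := lbody_next td xy; have bd := lbody_gt0_add td xc.
have [dx|dx] := ltP (b x) (b (padd x (padd x y))); last first.
  apply: IH => //; first exact: markov_next.
    exact: le_trans dx xK.
  have M' := markov_next xy M.
  suff: b (padd x (padd x y)) + eta <= b y by move: S; rewrite -natr1 mulrDl mul1r; lra.
  apply: (@descent_gap (b x) (b y) (b (padd x y)) _ K eta kap) => //; first by left.
    by apply: (@markov_ge (b y) (b (padd x y))) => //; rewrite [RHS](_ : _ = kap * b x * b y * b (padd x y)); [rewrite -M; ring|ring].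
  exact: markov_ge M.
have [dc|dc] := ltP (b (padd x y)) (b (padd x (padd x y))); first exact: growing_sector.
apply: IH => //; first exact: markov_next.
  exact: le_trans dc cK.
suff: b (padd x (padd x y)) + eta <= b y by move: S; rewrite -natr1 mulrDl mul1r; lra.
apply: (@descent_gap (b x) (b y) (b (padd x y)) _ K eta kap) => //; first by right.
  by apply: (@markov_ge (b y) (b (padd x y))) => //; rewrite [RHS](_ : _ = kap * b x * b y * b (padd x y)); [rewrite -M; ring|ring].
exact: markov_ge M.
Qed.

Lemma sector_bounded delta x y : 0 < delta -> unimodular x y ->
  bounded_sector Lam delta x y.
Proof.
move=> d0 xy; have bx := lbody_gt0l td xy; have by0 := lbody_gt0r td xy.
have bc := lbody_gt0_add td xy.
pose S := b x + b y + b (padd x y).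
pose P := b x * b y * b (padd x y).
have P0 : 0 < P by rewrite !mulr_gt0.
pose kap := (b x ^+ 2 + b y ^+ 2 + b (padd x y) ^+ 2) / P.
have kap0 : 0 < kap by rewrite divr_gt0 // !addr_gt0 ?exprn_gt0.
have S0 : 0 < S by rewrite !addr_gt0.
pose eta := (2 / kap) ^+ 2 / S.
have eta0 : 0 < eta by rewrite divr_gt0 // exprn_gt0 // divr_gt0.
(* The initial sum S serves as the bound K, and n gaps of size eta exceed it. *)
have [n Sn] : exists n, S / eta < n%:R.
  by exists (Num.bound (S / eta)); rewrite archi_boundP // ltW // divr_gt0.
apply: (@descent delta kap S eta n) => //.
- have kapP : kap * P = b x ^+ 2 + b y ^+ 2 + b (padd x y) ^+ 2 by rewrite divfK ?gt_eqF.
  by rewrite /markov -kapP /P !mulrA.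
- by rewrite /S -addrA lerDl addr_ge0 ?ltW.
- by rewrite /S [b x + _]addrC -addrA lerDl addr_ge0 // ltW.
- by rewrite /S lerDr addr_ge0 // ltW.
- by rewrite -ler_pdivrMr // ltW.
Qed.

End Descent.

(** * Super lambda-lengths and mu-invariants *)

Section PointData.
Variables (R : realType) (N : nat).
Local Notation galg := (galg R N).
Local Notation evalg := (evalg R N).
Variables (lam : farc -> grass R N) (mu : farc -> farc -> grass R N * grass R N).
Hypothesis sp : super_torus_point lam mu.

(** No projection takes place: [insubd] returns x itself when x is even and the default 0
    otherwise. *)
Definition even_part_of (x : galg) : evalg := insubd (0 : evalg) x.
Definition evlam x : evalg := even_part_of (lam x).
Definition muL x y : galg := (mu x y).1.
Definition muR x y : galg := (mu x y).2.
Definition evmu x y : evalg := even_part_of (muL x y * muR x y).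

Lemma even_part_ofK (x : galg) : geven x -> evval (even_part_of x) = x.
Proof. by move=> xe; rewrite insubdK //; apply/gevenbP. Qed.

Lemma unimodular_prim x y : unimodular x y -> prim x.
Proof.
rewrite /unimodular /det => xy; apply/coprimezP.
have [D|D] : (x.1 * y.2 - x.2 * y.1 = 1) \/ (x.1 * y.2 - x.2 * y.1 = -1) by lia.
- by exists (y.2, - y.1); rewrite /= -D; ring.
- by exists (- y.2, y.1); rewrite /= -[RHS]opprK -D; ring.
Qed.

Lemma evlamE x : prim x -> evval (evlam x) = lam x.
Proof. by case: sp => H _ /H [xe _]; apply: even_part_ofK. Qed.

Lemma nrm_neg x : nrm (pneg x) = nrm x.
Proof.
case: x => a c; rewrite /nrm /pneg /=.
have [c0|c0|c0] := ltgtP c 0.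
- by rewrite oppr_lt0 oppr_eq0 ltNge (ltW c0) /= (lt_eqF c0).
- by rewrite oppr_lt0 c0 /= !opprK.
- rewrite c0 oppr0 ltxx eqxx /= oppr_lt0 opprK.
  by have [a0|a0|->] := ltgtP a 0; rewrite ?oppr0.
Qed.

Lemma mu_sym x y : unimodular x y -> mu y x = mu x y.
Proof.
case: sp => _ [_ [_ [H _]]] xy; apply: H => //; first exact: unimodularC.
by rewrite /tri_seq [padd y x]paddC; apply/permP => a /=; rewrite addnCA.
Qed.

(** Up to signs of slopes, {x, -(x+y), -y} and {x, y, x+y} are the same triangulation. *)
Lemma mu_neg_add x y : unimodular x y -> mu x (pneg (padd x y)) = mu x y.
Proof.
case: sp => _ [_ [_ [H _]]] xy; apply: H => //.
  by apply/unimodular_neg/unimodular_add.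
rewrite /tri_seq padd_pneg_padd !nrm_neg; apply/permP => a /=.
by rewrite !addn0; congr (_ + _)%N; rewrite addnC.
Qed.

Lemma mu_odd x y : unimodular x y -> godd (muL x y) /\ godd (muR x y).
Proof. by case: sp => _ [_ [H _]]; exact: H. Qed.

Lemma godd_mul1even (x y : galg) : godd x -> godd y -> geven (x * y).
Proof.
move=> xo yo S oS; rewrite mulgE big1 // => A AS.
case oA: (odd #|A|); last by rewrite (xo _ (negbT oA)) mulr0 mul0r.
by rewrite [y _]yo ?mulr0 // odd_cardD // oS oA.
Qed.

Lemma godd_sq (x : galg) : godd x -> x * x = 0.
Proof.
move=> xo; have := godd_anticomm xo xo; set z := x * x => zN.
apply/ffunP => S; rewrite galg0.
have zS : z S = - z S by rewrite {1}zN galgN.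
lra.
Qed.

Lemma evmuE x y : unimodular x y -> evval (evmu x y) = muL x y * muR x y.
Proof. by move/mu_odd => [o1 o2]; apply: even_part_ofK; apply: godd_mul1even. Qed.

Lemma gadd_add (x y : galg) : gadd x y = x + y.
Proof. by apply/ffunP => S; rewrite [LHS]ffunE [RHS]galgD. Qed.

Lemma gscale_sgnb e (x : galg) : gscale (sgnb R e) x = (-1) ^+ e * x.
Proof.
apply/ffunP => S; rewrite [LHS]ffunE /sgnb.
by case: e; rewrite ?expr1 ?mulN1r ?expr0 ?mul1r // [RHS]galgN.
Qed.

Lemma gscaleN_sgnb e (x : galg) : gscale (- sgnb R e) x = - ((-1) ^+ e * x).
Proof. by rewrite -gscale_sgnb; apply/ffunP => S; rewrite [LHS]ffunE [RHS]galgN ffunE mulNr. Qed.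

(* The transformed mu-invariants are, up to the factor sqrt(p^2 + q^2), a
   rotation of the old ones, so their product is unchanged. *)
Lemma rotated_product (p q s0 t0 : galg) (s : bool) :
  geven p -> geven q -> godd s0 -> godd t0 ->
  (p * s0 + (-1) ^+ s * (q * t0)) * (p * t0 - (-1) ^+ s * (q * s0)) =
    (p * p + q * q) * (s0 * t0).
Proof.
move=> pe qe so to.
have swap (a c x y : galg) : geven c -> (a * x) * (c * y) = a * c * (x * y).
  by move=> ce; rewrite -mulrA (mulrA x) -(geven_comm x ce) !mulrA.
have ts : t0 * s0 = - (s0 * t0) by exact: godd_anticomm.
have ss := godd_sq so; have tt := godd_sq to.
case: s; rewrite ?expr1 ?mulN1r ?expr0 ?mul1r ?opprK.
- rewrite mulrBl mulrDr mulrDr 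
    (swap p p) // (swap p q) // (swap q p) // (swap q q) // ss tt ts !mulr0 addr0 add0r.
  by rewrite mulrN opprK mulrDl.
- rewrite mulrDl mulrBr mulrBr 
    (swap p p) // (swap p q) // (swap q p) // (swap q q) // ss tt ts !mulr0 subr0 sub0r.
  by rewrite mulrN opprK mulrDl.
Qed.

Lemma even_unit (r : galg) : geven r -> body r != 0 -> exists r' : galg, r' * r = 1.
Proof.
move=> re r0; pose z : evalg := cst N (body r)^-1 * even_part_of r.
have z1 : ebody z = 1.
  by rewrite ebodyM ebody_cst /ebody /gbody even_part_ofK // mulVf.
have [z' zK] := even_inverse z1.
exists (evval (z' * cst N (body r)^-1)); rewrite -[X in _ * X](even_part_ofK re).
by rewrite -[LHS]/(evval (z' * cst N (body r)^-1 * even_part_of r)) -mulrA mulrC -/z zK.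
Qed.

Lemma evval_sign (e : bool) (z : evalg) :
  evval ((-1) ^+ e * z) = (-1) ^+ e * evval z.
Proof. by case: e. Qed.

(** Up to sign, r^2 u v = (r u)(r v) is the rotated product (p^2 + q^2) s0 t0 = r^2 s0 t0, and r is
    invertible. *)
Lemma evmu_neg x y : unimodular x y ->
  exists s : bool, evmu x (pneg y) = (-1) ^+ s * evmu x y.
Proof.
move=> xy; have xy' := unimodular_neg xy.
have [so to] := mu_odd xy; have [uo vo] := mu_odd xy'.
have xe : geven (lam x) by case: sp => /(_ x (unimodular_prim xy)) [].
have ye : geven (lam y) by case: sp => /(_ y (unimodular_prim (unimodularC xy))) [].
have [r [re r0 rr [sw [sab [s [e1 [e2 []]]]]]]] : muflip_rel lam mu x y.
  by case: sp => _ [_ [_ [_ [_ H]]]]; exact: H.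
move: rr.
set rg : galg := r in re r0 *.
set a : galg := lam x in xe *; set c : galg := lam y in ye *.
rewrite -/(muL x y) -/(muR x y) -/(muL x (pneg y)) -/(muR x (pneg y)).
set s0 := muL x y in so *; set t0 := muR x y in to *.
set s1 := muL x (pneg y) in uo *; set t1 := muR x (pneg y) in vo *.
set p : galg := if sab then c else a; set q : galg := if sab then a else c.
set u : galg := if sw then t1 else s1; set v : galg := if sw then s1 else t1.
rewrite !gadd_add !gscale_sgnb gscaleN_sgnb.
rewrite -[gmul rg rg]/(rg * rg) -[gmul a a]/(a * a) -[gmul c c]/(c * c).
rewrite -[gmul rg u]/(rg * u) -[gmul rg v]/(rg * v).
rewrite -[gmul p s0]/(p * s0) -[gmul q t0]/(q * t0).
rewrite -[gmul p t0]/(p * t0) -[gmul q s0]/(q * s0).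
move=> rr ru rv.
have pe : geven p by rewrite /p; case: (sab).
have qe : geven q by rewrite /q; case: (sab).
have pq : p * p + q * q = rg * rg.
  by rewrite rr /p /q; case: (sab) => //; rewrite addrC.
have [r' rK] := even_unit re (lt0r_neq0 r0).
have uv : u * v = (-1) ^+ (e1 (+) e2) * (s0 * t0).
  have E : rg * rg * (u * v) = rg * rg * ((-1) ^+ (e1 (+) e2) * (s0 * t0)).
    transitivity (rg * u * (rg * v)).
      by rewrite -!mulrA; congr (_ * _); rewrite mulrA (geven_comm u re) -mulrA.
    have -> : rg * u * (rg * v) = (-1) ^+ (e1 (+) e2) *
        ((p * s0 + (-1) ^+ s * (q * t0)) * (p * t0 - (-1) ^+ s * (q * s0))).
      rewrite ru rv; case: (e1); case: (e2);
        by rewrite /= ?expr1 ?expr0 ?mulN1r ?mul1r ?mulrN ?mulNr ?opprK.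
    rewrite rotated_product // pq; case: (_ (+) _);
      by rewrite /= ?expr1 ?expr0 ?mulN1r ?mul1r ?mulrN.
  have RK (z : galg) : r' * (r' * (rg * rg * z)) = z.
    by rewrite !mulrA -(mulrA r') rK mulr1 rK mul1r.
  by rewrite -[LHS]RK E RK.
(* Exchanging the labels of the two triangles swaps two odd elements, hence the extra sign [sw]. *)
exists (e1 (+) e2 (+) sw); apply: val_inj.
rewrite -[LHS]/(evval _) -[RHS]/(evval _) evval_sign !evmuE //.
rewrite -/s0 -/t0 -/s1 -/t1; move: uv; rewrite /u /v; case: (sw) => uv.
  rewrite (godd_anticomm uo vo) uv.
  by case: (e1 (+) e2); rewrite /= ?expr1 ?expr0 ?mulN1r ?mul1r ?opprK.
by rewrite uv addbF.
Qed.

(** Flipping 2x+y in {x, x+y, 2x+y} leads back to {x, y, x+y}, so [evmu_neg] is read backwards. *)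
Lemma evmu_next x y : unimodular x y ->
  exists s : bool, evmu x (padd x y) = (-1) ^+ s * evmu x y.
Proof.
move=> xy; have [s E] := evmu_neg (unimodular_add xy); exists s.
have -> : evmu x y = evmu x (pneg (padd x y)) by rewrite /evmu /muL /muR mu_neg_add.
by rewrite E signrMK.
Qed.

Lemma point_torus_data : torus_data evlam evmu.
Proof.
split.
- move=> x y xy; have px := unimodular_prim xy.
  by case: sp => /(_ x px) [_ H] _; rewrite /lbody /ebody /gbody evlamE.
- by move=> x; case: sp => _ [H _]; rewrite /evlam H.
- move=> x y xy; have [e pt] : ptolemy_rel lam mu x y.
    by case: sp => _ [_ [_ [_ [H _]]]]; exact: H.
  exists e; apply: val_inj => /=; move: pt.
  rewrite !gadd_add gscale_sgnb.
  have px := unimodular_prim xy; have py := unimodular_prim (unimodularC xy).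
  have pc := unimodular_prim (unimodularC (unimodular_add xy)).
  have pd := unimodular_prim (unimodularC (unimodular_add (unimodular_neg xy))).
  rewrite -(evlamE px) -(evlamE py) -(evlamE pc) -(evlamE pd).
  rewrite -[gmul (mu x y).1 _]/(muL x y * muR x y) -evmuE // => pt.
  by apply: (etrans pt); case: (e).
- exact: evmu_next.
- by move=> x y xy; rewrite /evmu /muL /muR mu_sym.
- move=> x y xy; rewrite /ebody /gbody evmuE //.
  rewrite -[body _]/(gbody _) bodyM /gbody /body.
  by have [o1 _] := mu_odd xy; rewrite o1 ?cards0 // mul0r.
Qed.

Lemma grnorm_soul_le (x : galg) : grnorm (soul x) <= wnorm 1 x.
Proof.
apply: ler_sum => S _; rewrite expr1n mulr1 !ffunE; case: eqP => [->|_].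
  by rewrite /body subrr normr0.
by rewrite addr0.
Qed.

End PointData.

(** * Covering all slopes by four quadrants *)

Lemma prim_comb (x : farc) : prim x -> exists p q (e1 e2 : bool),
  coprime p q /\ x = comb p q ((-1) ^+ e1, 0) (0, (-1) ^+ e2).
Proof.
move=> px; exists `|x.1|%N, `|x.2|%N, (x.1 < 0), (x.2 < 0).
split; first by move: px; rewrite /prim /coprimez /gcdz /coprime; lia.
case: x {px} => a c; rewrite /comb /= !mulr0 addr0 add0r.
by rewrite !abszE ![`|_| * _]mulrC -!numEsign.
Qed.

Lemma unimodular_axes (e1 e2 : bool) : unimodular ((-1) ^+ e1, 0) (0, (-1) ^+ e2).
Proof. by rewrite /unimodular /det /= mulr0 subr0; case: e1; case: e2. Qed.

Theorem theorem5p5 (R : realType) (N : nat) (lam : farc -> grass R N)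
    (mu : farc -> farc -> grass R N * grass R N) :
  super_torus_point lam mu ->
  forall delta : R, 0 < delta ->
  exists M : R, 1 <= M /\
    forall x : farc, prim x ->
      grnorm (soul (lam x)) <= M * `|body (lam x)| `^ (1 + delta).
Proof.
move=> sp delta delta0; have td := point_torus_data sp.
(* The signed coordinate axes span four sectors, one per quadrant, which together contain every
   slope. *)
have bs (e1 e2 : bool) := sector_bounded td delta0 (unimodular_axes e1 e2).
have [M HM] : exists M : bool -> bool -> R, forall (e1 e2 : bool) (p q : nat),
    coprime p q -> let z := comb p q ((-1) ^+ e1, 0) (0, (-1) ^+ e2) in
    ewnorm 1 (evlam lam z) <= M e1 e2 * lbody (evlam lam) z `^ (1 + delta).
  have [M1 H1] := bs false false; have [M2 H2] := bs false true.
  have [M3 H3] := bs true false; have [M4 H4] := bs true true.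
  exists (fun e1 e2 => if e1 then (if e2 then M4 else M3) else (if e2 then M2 else M1)).
  by move=> [] [] p q cpq; [apply: H4|apply: H3|apply: H2|apply: H1].
(* The sum dominates each of the four constants, whatever their signs, and the summand 1 ensures M
   >= 1. *)
exists (1 + \sum_e1 \sum_e2 `|M e1 e2|); split.
  by rewrite lerDl; apply: sumr_ge0 => e1 _; apply: sumr_ge0.
move=> x px; have [_ bx] : geven (lam x) /\ 0 < body (lam x) by case: sp => H _; exact: H.
apply: le_trans (grnorm_soul_le _) _.
rewrite gtr0_norm //; have [p [q [e1 [e2 [cpq xE]]]]] := prim_comb px.
have := HM e1 e2 p q cpq; rewrite /= -xE /lbody /ebody /gbody /ewnorm (evlamE sp px).
move=> H; apply: le_trans H _; rewrite ler_wpM2r ?powR_ge0 //.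
apply: le_trans (ler_norm _) _.
rewrite (bigD1 e1) //= (bigD1 e2) //= addrCA -[leLHS]addr0 -addrA lerD2l.
by rewrite !addr_ge0 // ?ler01 ?sumr_ge0 // => e _; rewrite sumr_ge0.
Qed.
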